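(* Let $\tau$ be a finite relational signature, let $A\in\mathsf{FIN}(\tau)$, and let $\mathcal{C}$ be either $[A]_{\leftrightarrow}$ or $\mathrm{CSP}(A)$. Then the following are equivalent: (i) $\mathcal{C}$ is decided by an adaptive left unbounded query algorithm over $\mathbb{B}$; (ii) $\mathcal{C}$ is decided by a non-adaptive left $k$-query algorithm over $\mathbb{B}$ for some $k$.
   Context: $\mathsf{FIN}(\tau)$ is the class of finite relational structures of signature $\tau$ with non-empty domain. $B\to A$ means there is a homomorphism from $B$ to $A$; $[A]_{\leftrightarrow}=\{B: A\to B\text{ and }B\to A\}$ and $\mathrm{CSP}(A)=\{B: B\to A\}$. $\hom_{\mathbb{B}}(F,D)$ is $1$ if $F\to D$ and $0$ otherwise. A non-adaptive left $k$-query algorithm over $\mathbb{B}$ is a pair $((F_1,\dots,F_k),X)$ with $F_i\in\mathsf{FIN}(\tau)$ and $X\subseteq\{0,1\}^k$; it decides $\{D:(\hom_{\mathbb{B}}(F_i,D))_{i=1}^k\in X\}$. For a set $\Sigma$, $\Sigma^{<\omega}$ is the set of finite strings over $\Sigma$; a subtree is a prefix-closed subset, a leaf an element with no proper extension. An adaptive left unbounded query algorithm over $\mathbb{B}$ is a function $G:\mathcal{T}\to\mathsf{FIN}(\tau)\cup\{\mathsf{YES},\mathsf{NO}\}$ with $\mathcal{T}\subseteq\{0,1\}^{<\omega}$ a subtree and $G(\sigma)\in\{\mathsf{YES},\mathsf{NO}\}$ iff $\sigma$ is a leaf; its computation path on $D$ is the limit of $\sigma_0=\varepsilon$, $\sigma_{i+1}=\sigma_i$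 if $G(\sigma_i)\in\{\mathsf{YES},\mathsf{NO}\}$, else $\sigma_{i+1}=\sigma_i\bullet\hom_{\mathbb{B}}(G(\sigma_i),D)$; it is required to be total (finite path on every input) and decides $\{D:G(\text{path of }D)=\mathsf{YES}\}$. *)

(* Defs.v *)
From mathcomp Require Import all_boot.

Set Implicit Arguments.
Unset Strict Implicit.
Unset Printing Implicit Defensive.

Record signature := Signature {
  symbol : finType;
  arity : symbol -> nat }.

Record structure (tau : signature) := Structure {
  dom :> finType;
  interp : forall R : symbol tau, {set (arity R).-tuple dom};
  dom_gt0 : 0 < #|dom| }.

Section Homomorphisms.

Variable tau : signature.
Implicit Types A B D F : structure tau.

Definition is_hom A B (h : A -> B) : Prop :=
  forall (R : symbol tau) (t : (arity R).-tuple A),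
    t \in interp A R -> map_tuple h t \in interp B R.

Definition homto A B : Prop := exists h : A -> B, is_hom h.

(* Boolean because all the types involved are finite; [homBP] below relates it
   to [homto]. *)
Definition homB F D : bool :=
  [exists h : {ffun F -> D},
    [forall R : symbol tau, forall t : (arity R).-tuple F,
      (t \in interp F R) ==> (map_tuple h t \in interp D R)]].

Lemma homBP F D : reflect (homto F D) (homB F D).
Proof.
apply: (iffP existsP) => [[h /forallP hh]|[h hh]].
  by exists h => R t; move/forallP: (hh R) => /(_ t) /implyP.
exists [ffun x => h x]; apply/forallP=> R; apply/forallP=> t; apply/implyP=> /hh.
suff -> : map_tuple h t = map_tuple [ffun x => h x] t by [].
by apply: val_inj => /=; apply: eq_map => x; rewrite ffunE.
Qed.

Definition hom_equiv_class A : structure tau -> Prop :=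
  fun B => homto A B /\ homto B A.

Definition CSP A : structure tau -> Prop := fun B => homto B A.

End Homomorphisms.

Record nonadaptive_algorithm (tau : signature) (k : nat) := Nonadaptive {
  queries : 'I_k -> structure tau;
  accepted : {set k.-tuple bool} }.

Definition nonadaptive_decides (tau : signature) (k : nat)
    (N : nonadaptive_algorithm tau k) (C : structure tau -> Prop) : Prop :=
  forall D, C D <->
    [tuple homB (queries N i) D | i < k] \in accepted N.

Definition subtree (T : bitseq -> Prop) : Prop :=
  forall s t : bitseq, prefix s t -> T t -> T s.

Definition leaf (T : bitseq -> Prop) (s : bitseq) : Prop :=
  T s /\ forall t : bitseq, T t -> prefix s t -> t = s.

Inductive label (tau : signature) :=
  | Query of structure tau
  | Yes
  | No.
Arguments Yes {tau}.
Arguments No {tau}.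

Definition is_answer (tau : signature) (l : label tau) : Prop :=
  l = Yes \/ l = No.

Section Computation.

Variables (tau : signature) (G : bitseq -> label tau) (D : structure tau).

Definition step (s : bitseq) : bitseq :=
  if G s is Query F then rcons s (homB F D) else s.

Definition run (n : nat) : bitseq := iter n step [::].

(* The limit of [run], when it is a finite string. *)
Definition computation_path (s : bitseq) : Prop :=
  exists n, forall m, n <= m -> run m = s.

End Computation.

(* The partial function G from T to structures, YES and NO is represented by its
   domain [tree] and a total extension [node] of it. The values of [node]
   outside [tree] are irrelevant: [total] places the final string of each
   computation in [tree], hence also, [tree] being prefix-closed, all the
   strings that precede it (in particular the empty one). *)
Record adaptive_algorithm (tau : signature) := Adaptive {
  tree : bitseq -> Prop;
  node : bitseq -> label tau;
  tree_subtree : subtree tree;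
  node_leaf : forall s, tree s -> (is_answer (node s) <-> leaf tree s);
  total : forall D, exists s, tree s /\ computation_path node D s }.

Definition adaptive_decides (tau : signature) (G : adaptive_algorithm tau)
    (C : structure tau -> Prop) : Prop :=
  forall D, C D <-> exists s, computation_path (node G) D s /\ node G s = Yes.

(* Main.v *)
Require Import Defs.
From mathcomp Require Import all_boot.

Set Implicit Arguments.
Unset Strict Implicit.
Unset Printing Implicit Defensive.

(** An accepting run on [A] asks finitely many queries, and every [D] answering
    them as [A] does is accepted too.  For the homomorphic equivalence class of
    [A] the converse is clear, so these queries with the answers of [A] form a
    non-adaptive algorithm.  For [CSP A], apply this to the disjoint union
    [D + A]: since [D -> A] iff [D + A] is homomorphically equivalent to [A],
    it is enough to decide whether [F -> D + A] for finitely many [F].  Such a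
    homomorphism splits [F] into a part mapped to [D] and a part mapped to [A],
    so [F -> D + A] is a finite disjunction of conditions [F' -> D]. *)

Lemma map_tuple_comp (n : nat) (X Y Z : Type) (g : Y -> Z) (h : X -> Y)
    (t : n.-tuple X) :
  map_tuple g (map_tuple h t) = map_tuple (g \o h) t.
Proof. by apply: val_inj; rewrite /= map_comp. Qed.

Section Homomorphisms.

Variable tau : signature.
Implicit Types A B D F : structure tau.

Lemma is_hom_comp A B D (g : B -> D) (h : A -> B) :
  is_hom g -> is_hom h -> is_hom (g \o h).
Proof.
by move=> hg hh R t /hh /hg; rewrite map_tuple_comp.
Qed.

Lemma homto_refl A : homto A A.
Proof.
by exists id => R t tA; rewrite (_ : map_tuple _ t = t) //; apply/val_inj/map_id.
Qed.

Lemma homto_trans B A D : homto A B -> homto B D -> homto A D.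
Proof. by move=> [h hh] [g hg]; exists (g \o h); apply: is_hom_comp. Qed.

Lemma homB_equiv F A B : homto A B -> homto B A -> homB F A = homB F B.
Proof.
by move=> AB BA; apply/homBP/homBP => FX; [apply: homto_trans FX AB | apply: homto_trans FX BA].
Qed.

Definition union_interp D A (R : symbol tau) : {set (arity R).-tuple (D + A)} :=
  (map_tuple inl @: interp D R) :|: (map_tuple inr @: interp A R).

Lemma union_dom_gt0 D A : 0 < #|{: D + A}|.
Proof. by rewrite card_sum addn_gt0 dom_gt0. Qed.

Definition disjoint_union D A : structure tau :=
  Structure (@union_interp D A) (union_dom_gt0 D A).

Lemma homto_inl D A : homto D (disjoint_union D A).
Proof. by exists inl => R t tD; rewrite inE imset_f. Qed.

Lemma homto_inr D A : homto A (disjoint_union D A).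
Proof. by exists inr => R t tA; rewrite inE orbC imset_f. Qed.

Lemma homto_union D A B : homto D B -> homto A B -> homto (disjoint_union D A) B.
Proof.
move=> [g hg] [h hh]; exists (fun x => match x with inl a => g a | inr a => h a end).
move=> R t; rewrite inE => /orP[] /imsetP[u uX ->].
  by rewrite map_tuple_comp; apply: hg.
by rewrite map_tuple_comp; apply: hh.
Qed.

Definition fact F : finType := {R : symbol tau & (arity R).-tuple F}.

Definition mkfact {F} {R : symbol tau} (t : (arity R).-tuple F) : fact F :=
  Tagged (fun R : symbol tau => (arity R).-tuple F) t.

(** The domain of [F] is kept, so that the result is non-empty; the additional
    isolated elements do not affect the existence of homomorphisms. *)
Definition restrict F (Q : {set fact F}) : structure tau :=
  Structure (fun R => [set t in interp F R | mkfact t \in Q]) (dom_gt0 F).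

(** Facts are split separately from elements because a nullary fact may hold on
    either side of a disjoint union. *)
Definition splitting F A (p : {set F} * {set fact F}) : bool :=
  [forall R : symbol tau, forall t : (arity R).-tuple F, (t \in interp F R) ==>
     all (fun x => (x \in p.1) == (mkfact t \in p.2)) t]
  && homB (restrict (~: p.2)) A.

Lemma splittingP F A (p : {set F} * {set fact F}) :
  reflect ((forall (R : symbol tau) (t : (arity R).-tuple F), t \in interp F R ->
              {in t, forall x, (x \in p.1) = (mkfact t \in p.2)})
           /\ homto (restrict (~: p.2)) A)
          (splitting A p).
Proof.
apply: (iffP andP) => -[] split_p /homBP homA; split=> //.
  move=> R t tF x xt; apply/eqP.
  by move/forallP: split_p => /(_ R)/forallP/(_ t)/implyP/(_ tF)/allP/(_ x xt).
apply/forallP=> R; apply/forallP=> t; apply/implyP=> tF; apply/allP=> x xt.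
by apply/eqP/split_p.
Qed.

(** The list depends on [F] and [A] only, not on [D], so its members can serve as fixed queries. *)
Definition left_parts F A : seq (structure tau) :=
  [seq restrict p.2 | p : {set F} * {set fact F} <- enum (splitting A)].

Lemma homB_union F D A :
  homB F (disjoint_union D A) = has (fun F' => homB F' D) (left_parts F A).
Proof.
rewrite has_map; apply/homBP/hasP => [[h hh]|[p]]; last first.
  rewrite mem_enum => /splittingP[split_p [gA hgA]] /homBP[gD hgD].
  (* By [split_p], all elements of a fact lie on the side assigned to that fact, so the glued map
     agrees on it with [gD] or with [gA] throughout. *)
  exists (fun x => if x \in p.1 then inl (gD x) else inr (gA x)) => R t tF.
  rewrite inE; have [tQ|tQ] := boolP (mkfact t \in p.2).
    apply/orP; left; apply/imsetP; exists (map_tuple gD t).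
      by apply: hgD; rewrite inE tF.
    apply: val_inj; rewrite /= -map_comp; apply/eq_in_map => x xt /=.
    by rewrite (split_p R t) // tQ.
  apply/orP; right; apply/imsetP; exists (map_tuple gA t).
    by apply: hgA; rewrite inE tF inE.
  apply: val_inj; rewrite /= -map_comp; apply/eq_in_map => x xt /=.
  by rewrite (split_p R t) // (negbTE tQ).
(* The defaults [d0] and [a0] are reached only at elements that occur in no fact of the restriction
   being mapped. *)
have /card_gt0P[d0 _] := dom_gt0 D; have /card_gt0P[a0 _] := dom_gt0 A.
pose isl (x : D + A) := if x is inl _ then true else false.
pose prl (x : D + A) := if x is inl d then d else d0.
pose prr (x : D + A) := if x is inr a then a else a0.
(* A nullary fact that holds in both [D] and [A] is put on the left. *)
pose Q := [set f : fact F |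
  map_tuple h (tagged f) \in map_tuple inl @: interp D (tag f)].
exists ([set x | isl (h x)], Q) => [|/=].
  rewrite mem_enum; apply/splittingP; split=> /= [R t tF x xt|].
    rewrite !inE /=; have := hh R t tF; rewrite inE.
    have [/imsetP[u _ htu] _|_ /imsetP[u _ htu]] /= := boolP (_ \in _).
      have: h x \in map_tuple h t by apply: map_f.
      by rewrite htu => /mapP[y _ ->].
    have: h x \in map_tuple h t by apply: map_f.
    by rewrite htu => /mapP[y _ ->].
  exists (prr \o h) => R t; rewrite !inE /= => /andP[tF tQ].
  have := hh R t tF; rewrite inE (negbTE tQ) /= => /imsetP[u uA htu].
  rewrite (_ : map_tuple _ t = u) //; apply: val_inj.
  by rewrite /= map_comp [map h t](congr1 val htu) /= -map_comp map_id.
apply/homBP; exists (prl \o h) => R t; rewrite !inE /= => /andP[tF].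
move=> /imsetP[u uD htu]; rewrite (_ : map_tuple _ t = u) //; apply: val_inj.
by rewrite /= map_comp [map h t](congr1 val htu) /= -map_comp map_id.
Qed.

End Homomorphisms.

Section Algorithms.

Variables (tau : signature) (C : structure tau -> Prop).
Implicit Types A D F : structure tau.

Lemma nonadaptive_of_seq (F0 : structure tau) (L : seq (structure tau)) (P : pred bitseq) :
  (forall D, C D <-> P [seq homB F D | F <- L]) ->
  exists (k : nat) (N : nonadaptive_algorithm tau k), nonadaptive_decides N C.
Proof.
move=> CP; exists (size L).
exists (Nonadaptive (fun i : 'I_(size L) => nth F0 L i)
                    [set t : (size L).-tuple bool | P t]) => D.
apply: (iff_trans (CP D)); rewrite inE; suff -> : [seq homB F D | F <- L]
  = [tuple homB (nth F0 L i) D | i < size L] by [].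
apply: (@eq_from_nth _ false); first by rewrite size_map size_tuple.
move=> i; rewrite size_map => ltiL; rewrite (nth_map F0) //.
by rewrite -[i in RHS]/(val (Ordinal ltiL)) -tnth_nth tnth_mktuple.
Qed.

(** The tree is the full binary tree of depth [k]: every node at depth [i < k] asks query [i],
    whatever the earlier answers, and the leaves are labelled according to [accepted N]. *)
Lemma adaptive_of_nonadaptive (k : nat) (N : nonadaptive_algorithm tau k) :
  nonadaptive_decides N C -> exists G : adaptive_algorithm tau, adaptive_decides G C.
Proof.
move=> NC.
pose T (s : bitseq) : Prop := size s <= k.
pose v D := [tuple homB (queries N i) D | i < k].
pose G (s : bitseq) : label tau :=
  if insub (size s) is Some i then Query (queries N i) else
  if insub s is Some t then (if t \in accepted N then Yes else No) else No.
have Gv D : G (v D) = if v D \in accepted N then Yes else No.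
  by rewrite /G insubN ?size_tuple ?ltnn // valK.
have runE D n : run G D n = take n (v D).
  elim: n => [|n IHn]; first by rewrite take0.
  rewrite /run iterS -/(run G D n) IHn /step.
  have [ltnk|lekn] := ltnP n k.
    have sz : size (take n (v D)) = n by rewrite size_takel // size_tuple ltnW.
    rewrite /G sz insubT (take_nth false) ?size_tuple //.
    by congr rcons; rewrite -[n in RHS]/(val (Ordinal ltnk)) -tnth_nth tnth_mktuple.
  by rewrite !take_oversize ?size_tuple ?Gv //; [case: ifP | apply: leqW].
have pathv D : computation_path G D (v D).
  by exists k => m lekm; rewrite runE take_oversize ?size_tuple.
have Tsub : subtree T.
  by move=> s t /prefixP[u ->]; rewrite /T size_cat; apply: leq_trans (leq_addr _ _).
have Gleaf s : T s -> (is_answer (G s) <-> leaf T s).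
  move=> Ts; rewrite /is_answer /G; case: insubP => [i ltsk _|lesk].
    split=> [[]//|[_ /(_ (rcons s true))]]; rewrite /T size_rcons ltsk.
    by move=> /(_ isT (prefix_rcons _ _))/(congr1 size)/eqP; rewrite size_rcons gtn_eqF.
  split=> [_|_]; last by case: insubP => [t _ _|_]; [case: ifP; auto | right].
  split=> // t; rewrite /T => letk /prefixP[[|b u] def_t]; first by rewrite def_t cats0.
  by move: letk lesk; rewrite def_t size_cat /= addnS => /(leq_ltn_trans (leq_addr _ _)) ->.
have Gtotal D : exists s, T s /\ computation_path G D s.
  by exists (v D); split; rewrite // /T size_tuple.
exists (Adaptive Tsub Gleaf Gtotal) => D; apply: (iff_trans (NC D)); rewrite -/(v D) /=.
split=> [acc|[s [[n runs]]]]; first by exists (v D); rewrite Gv acc.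
(* At time [maxn n k] the run has reached both [s] and [v D], so the two coincide. *)
rewrite -(runs (maxn n k)) ?leq_maxl // runE take_oversize ?size_tuple ?leq_maxr //.
by rewrite Gv; case: ifP.
Qed.

(** [L] collects the queries met by the run on [A]; as long as [D] gives the same answers, its run
    meets the same ones. *)
Lemma run_queries (G : bitseq -> label tau) A (n : nat) :
  exists L : seq (structure tau), forall D,
    [seq homB F D | F <- L] = [seq homB F A | F <- L] -> run G D n = run G A n.
Proof.
elim: n => [|n [L IH]]; first by exists [::].
rewrite /run; exists (if G (run G A n) is Query F then F :: L else L) => D.
rewrite !iterS -/(run G D n) -/(run G A n) /step.
by case GA: (G _) => [F||] => [[<-]||] /IH ->; rewrite GA.
Qed.

Lemma accept_queries (G : adaptive_algorithm tau) A :
  adaptive_decides G C -> C A ->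
  exists L : seq (structure tau), forall D,
    [seq homB F D | F <- L] = [seq homB F A | F <- L] -> C D.
Proof.
move=> GC /GC[s [[n runs] Gs]]; have [L LP] := run_queries (node G) A n.
exists L => D /LP; rewrite runs // => runD; apply/GC; exists s; split=> //.
(* A node labelled [Yes] is fixed by [step], so the run on [D] stays at [s]. *)
exists n => m /subnK <-; elim: (m - n) => [//|j IHj].
by rewrite /run addSn iterS -/(run (node G) D (j + n)) IHj /step Gs.
Qed.

End Algorithms.

Lemma nonadaptive_hom_equiv_class (tau : signature) (A : structure tau)
    (G : adaptive_algorithm tau) :
  adaptive_decides G (hom_equiv_class A) ->
  exists (k : nat) (N : nonadaptive_algorithm tau k),
    nonadaptive_decides N (hom_equiv_class A).
Proof.
move=> GC; have [|L LP] := accept_queries (A := A) GC; first by split; apply: homto_refl.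
apply: (nonadaptive_of_seq A (L := L) (P := pred1 [seq homB F A | F <- L])) => D.
split=> [[AD DA]|/eqP /LP //].
by apply/eqP/eq_map => F; apply: homB_equiv.
Qed.

Lemma nonadaptive_CSP (tau : signature) (A : structure tau)
    (G : adaptive_algorithm tau) :
  adaptive_decides G (CSP A) ->
  exists (k : nat) (N : nonadaptive_algorithm tau k), nonadaptive_decides N (CSP A).
Proof.
move=> GC; have [|L LP] := accept_queries (A := A) GC; first exact: homto_refl.
(* If [F] maps to [A], it maps to [D + A] for every [D]; only the other members of [L] can tell
   [D + A] from [A]. *)
pose L' := flatten [seq left_parts F A | F <- L & ~~ homB F A].
apply: (nonadaptive_of_seq A (L := L') (P := fun s => ~~ has id s)) => D.
have -> : has id [seq homB F D | F <- L']
    = has (fun F => ~~ homB F A && homB F (disjoint_union D A)) L.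
  rewrite has_map {}/L'; elim: L {LP} => //= F L <-.
  by rewrite homB_union; case: (homB F A) => //=; rewrite has_cat.
split=> [DA|nhas].
  rewrite -all_predC; elim: L {LP L'} => //= F L ->.
  rewrite (@homB_equiv _ F (disjoint_union D A) A) ?andNb //.
    exact: homto_union DA (homto_refl A).
  exact: homto_inr.
(* [LP] is applied to [D + A]: queries failing in [A] fail there by [nhas], and those holding in [A]
   persist along [A -> D + A]. *)
apply: homto_trans (homto_inl D A) _; apply: LP.
elim: L nhas {L'} => //= F L IH; rewrite negb_or => /andP[nF /IH ->]; congr cons.
have [FA|nFA] := boolP (homB F A); last by move: nF; rewrite nFA => /negbTE.
by apply/homBP; apply: homto_trans (homto_inr D A); apply/homBP.
Qed.

Theorem theorem25 (tau : signature) (A : structure tau)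
    (C : structure tau -> Prop)
    (hC : C = hom_equiv_class A \/ C = CSP A) :
  (exists G : adaptive_algorithm tau, adaptive_decides G C) <->
  (exists (k : nat) (N : nonadaptive_algorithm tau k), nonadaptive_decides N C).
Proof.
split=> [[G]|[k [N]]]; last exact: adaptive_of_nonadaptive.
by case: hC => ->; [apply: nonadaptive_hom_equiv_class | apply: nonadaptive_CSP].
Qed.
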